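(* Let $k \in \mathbb{N}$, $k\ge 2$ be fixed. Then $$\sum_{n_1,\ldots, n_k \le x} B \left( (n_1,\dotsc,n_k) \right) = x^k \sum_p \frac{1}{p^{k-1}(p^k-1)} + \begin{cases} O(x^{k-1}), & \text{if } k\ge 3,\\ O(x\log \log x), & \text{if } k=2.\end{cases}$$
   Context: $\mathbb{N}=\{1,2,\ldots\}$. For a positive integer $n$, $A(n)=\sum_{p^\nu \| n} \nu p$ (sum over the prime powers $p^\nu$, $\nu\ge1$, exactly dividing $n$), $A^*(n)=\sum_{p\mid n} p$ (sum over the distinct prime divisors of $n$), and $B(n)=A(n)-A^*(n)$. $(n_1,\ldots,n_k)$ as an argument of $B$ denotes the greatest common divisor; the sum runs over all $k$-tuples of positive integers not exceeding $x$. $\sum_p$ runs over all primes. The asymptotic formula is for real $x\to\infty$; the implied constant may depend on $k$. *)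

(* Defs.v *)
From mathcomp Require Import all_boot all_order all_algebra.
From mathcomp Require Import all_classical all_reals all_analysis.

Set Implicit Arguments.
Unset Strict Implicit.
Unset Printing Implicit Defensive.

Import Order.TTheory GRing.Theory Num.Theory.
Import numFieldNormedType.Exports.

Local Open Scope ring_scope.
Local Open Scope classical_set_scope.

Definition A (n : nat) : nat := (\sum_(p <- primes n) logn p n * p)%N.

Definition Astar (n : nat) : nat := (\sum_(p <- primes n) p)%N.

Definition B (n : nat) : int := (A n)%:Z - (Astar n)%:Z.

(* The index set is all k-tuples with entries in {1, ..., floor x}: the
   truncation [Num.truncn x] is floor x for x >= 0 and 0 for x < 0. *)
Definition gcdSum (R : realType) (k : nat) (x : R) : int :=
  \sum_(n : {ffun 'I_k -> 'I_(Num.truncn x).+1} | [forall i, (0 < n i)%N])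
     B (\big[gcdn/0%N]_(i < k) n i).

Definition primeSeries (R : realType) (k : nat) : R^nat := fun N =>
  \sum_(0 <= p < N | prime p) (p%:R ^+ k.-1 * (p%:R ^+ k - 1))^-1.

(* The limit below is a genuine limit only by virtue of this fact. *)
Lemma is_cvg_primeSeries (R : realType) (k : nat) :
  (2 <= k)%N -> cvgn (primeSeries R k).
Proof.
move=> k2.
have term_ge0 p : prime p -> 0 <= (p%:R ^+ k.-1 * (p%:R ^+ k - 1))^-1 :> R.
  move=> /prime_gt0 p0; rewrite invr_ge0 mulr_ge0 ?exprn_ge0//.
  by rewrite subr_ge0 exprn_ege1// ler1n.
have term_le p : prime p ->
    (p%:R ^+ k.-1 * (p%:R ^+ k - 1))^-1 <= p.-1%:R^-1 - p%:R^-1 :> R.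
  move=> /prime_gt1; case: p => [|[|q]]//= _.
  have q0 : 0 < q.+1%:R :> R by [].
  have q1 : 0 < q.+2%:R :> R by [].
  have -> : q.+1%:R^-1 - q.+2%:R^-1 = (q.+2%:R * q.+1%:R)^-1 :> R.
    apply/(mulIf (lt0r_neq0 (mulr_gt0 q1 q0))).
    rewrite mulVf ?lt0r_neq0 ?mulr_gt0// mulrBl.
    rewrite [in X in X - _]mulrCA mulVf ?lt0r_neq0// mulr1 mulrA mulVf ?lt0r_neq0//.
    by rewrite mul1r -natrB// subSnn.
  have h1 : (q.+2%:R : R) <= q.+2%:R ^+ k.-1.
    by rewrite -[leLHS]expr1 ler_weXn2l ?ler1n//; case: (k) k2 => [|[]].
  have h2 : (q.+1%:R : R) <= q.+2%:R ^+ k - 1.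
    rewrite lerBrDr natr1 -[leLHS]expr1 ler_weXn2l ?ler1n//.
    exact: ltnW.
  have p1 := lt_le_trans q1 h1; have p2 := lt_le_trans q0 h2.
  rewrite lef_pV2 ?posrE; [|exact: mulr_gt0..].
  by apply: ler_pM => //; exact: ltW.
have nd : nondecreasing_seq (primeSeries R k).
  apply/nondecreasing_seqP => N.
  rewrite /primeSeries [leRHS]big_mkcond big_nat_recr//= -big_mkcond/= lerDl.
  by case: ifP => // /term_ge0.
have ub N : primeSeries R k N.+2 <= 1 - N.+1%:R^-1.
  elim: N => [|N IH].
    by rewrite /primeSeries big_mkcond !big_nat_recr//= big_geq// !addr0 invr1 subrr.
  rewrite /primeSeries big_mkcond big_nat_recr//= -big_mkcond/= -/(primeSeries R k N.+2).
  have step : (if prime N.+2 then (N.+2%:R ^+ k.-1 * (N.+2%:R ^+ k - 1))^-1 else 0)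
      <= N.+1%:R^-1 - N.+2%:R^-1 :> R.
    case: ifPn => [|_]; first exact: term_le.
    by rewrite subr_ge0 lef_pV2 ?posrE ?ltr0n// ler_nat.
  by apply: le_trans (lerD IH step) _; rewrite addrA subrK.
apply: nondecreasing_is_cvgn => //; exists 1 => _ [N _ <-].
apply: le_trans (nd N N.+2 _) _; first by rewrite -addn2 leq_addr.
by apply: le_trans (ub N) _; rewrite lerBlDr lerDl invr_ge0.
Qed.

Definition primeConst (R : realType) (k : nat) : R := limn (primeSeries R k).

(* Lets [+oo_R] occur as the filter of a big-O. *)
Canonical pinfty_filter_on (R : numFieldType) :=
  FilterType (pinfty_nbhs R) (@proper_pinfty_nbhs R).

(* Main.v *)
Require Import Defs.
From mathcomp Require Import all_boot all_order all_algebra.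
From mathcomp Require Import all_classical all_reals all_analysis.
From mathcomp Require Import ring lra zify.

Import Order.TTheory GRing.Theory Num.Theory.
Import numFieldNormedType.Exports.

Local Open Scope ring_scope.
Local Open Scope classical_set_scope.

(** If [p ^ v] exactly divides [n], then [p] contributes [(v - 1) * p] to
    [B n], which is [p] for each exponent [a >= 2] with [p ^ a] dividing [n].
    A prime power divides a gcd iff it divides all the entries, so with
    [N = floor x] the sum to be estimated is exactly

      [sum_(p <= N) sum_(a >= 2) p * floor (x / p ^ a) ^ k]

    ([gcdSum_floor]).  Dropping the floors turns the inner sum into a geometric
    series with value [x ^ k * c_p], where [c_p = 1 / (p ^ (k-1) (p ^ k - 1))]
    is the term of the series that defines the constant.

    Three errors arise, all nonnegative, and they are added up in
    [gcdSum_error_bound].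
    - Since [y ^ k - floor y ^ k <= k y ^ (k-1)], dropping the floors costs at
      most [k x ^ (k-1)] times [sum_(a >= 2) p / P ^ a <= 2 p / P ^ 2], where
      [P = p ^ (k-1)].
    - Only exponents [a <= N + 1] are kept in the geometric series.  As
      [p ^ N >= x], what is missing is at most [c_p], and the [c_p] have a
      finite sum.
    - The primes beyond [N] are missing.  As [c_p <= 1 / (p-1) - 1 / p], their
      [c_p] telescope to at most [1 / N], and [x ^ k / N <= 2 x ^ (k-1)].

    So the error is governed by [sum_(p <= N) p / p ^ (2 (k-1))].  For [k >= 3]
    this is bounded, again by telescoping ([errorSum_le1]).  For [k = 2] it is
    [sum_(p <= N) 1 / p], for which an upper bound of order [ln (ln x)] is
    needed ([sum_inv_primes_le_lnln]).  It follows from Chebyshev's argument in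
    dyadic blocks: the primes in [(n, 2 n]] all divide the central binomial
    coefficient, which is at most [4 ^ n], so for [n = 2 ^ j] there are at most
    [2 ^ (j+1) / j] of them, with reciprocals summing to at most [2 / j];
    the blocks up to [x] then give a harmonic sum of length about [log x]. *)

(** * The gcd sum as a sum over prime powers *)

Lemma logn_pred_sum_dvd p n N : prime p -> (0 < n <= N)%N ->
  (logn p n).-1 = (\sum_(2 <= a < N.+2) (p ^ a %| n))%N.
Proof.
move=> p_pr /andP[n0 nN].
have lN : (logn p n <= N)%N by apply: leq_trans nN; exact/ltnW/ltn_logl.
rewrite (eq_bigr (fun a => (a < (logn p n).+1) : nat)); last first.
  by move=> a _; rewrite pfactor_dvdn.
rewrite (bigID (fun a => a < (logn p n).+1)%N) /=.
rewrite [X in (_ + X)%N]big1 ?addn0; last by move=> a /negbTE ->.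
case: (leqP (logn p n) 1) => l1.
  rewrite big_nat_cond big1 => [|a /andP[/andP[a2 _]]]; last by lia.
  by case: logn l1 => [|[]].
rewrite (eq_bigr (fun=> 1%N)); last by move=> a ->.
rewrite -(big_nat_widen 2 (logn p n).+1 N.+2 predT) /=; last by lia.
by rewrite sum_nat_const_nat; lia.
Qed.

(** The bounds [N] on the ranges of [p] and [a] are independent of [n], so that
    the sums can later be exchanged with a sum over [n]. *)
Lemma B_sum_prime_powers n N : (0 < n <= N)%N ->
  B n = (\sum_(0 <= p < N.+1 | prime p)
           \sum_(2 <= a < N.+2) p * (p ^ a %| n))%N :> int.
Proof.
move=> nN; have /andP[n0 nleN] := nN.
have -> : B n = (\sum_(p <- primes n) (logn p n).-1 * p)%N :> int.
  rewrite /B /A /Astar.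
  have -> : (\sum_(p <- primes n) logn p n * p =
      \sum_(p <- primes n) (logn p n).-1 * p + \sum_(p <- primes n) p)%N.
    rewrite -big_split/=; apply: eq_big_seq => p pn.
    by rewrite -mulSnr prednK // logn_gt0.
  by rewrite PoszD addrK.
congr Posz.
rewrite (eq_bigr (fun p => p * (logn p n).-1)%N) => [|p _]; last by rewrite mulnC.
transitivity (\sum_(0 <= p < N.+1 | p \in primes n) p * (logn p n).-1)%N.
  rewrite -[RHS]big_filter; apply: perm_big; apply: uniq_perm.
  - exact: primes_uniq.
  - by rewrite filter_uniq // iota_uniq.
  move=> p; rewrite mem_filter mem_index_iota.
  case: (boolP (p \in primes n)) => //=.
  rewrite mem_primes => /and3P[_ _ /dvdn_leq]; lia.
rewrite big_mkcond [RHS]big_mkcond; apply: eq_bigr => p _.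
rewrite mem_primes n0 /=; case: (boolP (prime p)) => //= p_pr.
rewrite -big_distrr/= -logn_pred_sum_dvd //; case: ifPn => // ndv.
by rewrite lognE p_pr n0 (negbTE ndv) muln0.
Qed.

Lemma card_multiples (N d : nat) :
  #|[pred m : 'I_N.+1 | (0 < m)%N && (d %| m)%N]| = (N %/ d)%N.
Proof.
rewrite divn_count_dvd -sum1_card big_mkcond /=.
rewrite big_add1 /= big_mkord big_ord_recl inE /= add0n.
by apply: eq_bigr => i _; rewrite inE /= /bump add1n; case: ifP.
Qed.

(** [d] divides the gcd of a tuple iff it divides every entry, so that the
    tuples counted are the functions into the positive multiples of [d]. *)
Lemma card_tuples_gcd_multiple (k N d : nat) :
  (\sum_(n : {ffun 'I_k -> 'I_N.+1} | [forall i, (0 < n i)%N])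
     (d %| \big[gcdn/0]_(i < k) n i))%N = ((N %/ d) ^ k)%N.
Proof.
rewrite -(card_multiples N d) -[X in (_ ^ X)%N]card_ord -card_ffun_on.
rewrite -sum1_card big_mkcond [RHS]big_mkcond; apply: eq_bigr => n _.
have -> : (n \in ffun_on [pred m : 'I_N.+1 | (0 < m)%N && (d %| m)%N]) =
  [forall i, (0 < n i)%N] && (d %| \big[gcdn/0%N]_(i < k) n i)%N.
  apply/ffun_onP/andP => [nP|[/forallP n0 /dvdn_biggcdP dn] i].
    split; first by apply/forallP => i; have /andP[] := nP i.
    by apply/dvdn_biggcdP => i _; have /andP[] := nP i.
  by rewrite inE /= n0 dn.
by case: [forall i, _] => //=; case: (d %| _)%N.
Qed.

(** The amount by which [p] enters the gcd sum over the tuples with entries at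
    most [N]: each prime power [p ^ a] with [a >= 2] divides the gcd of
    [(N %/ p ^ a) ^ k] tuples, and contributes [p] every time. *)
Definition primeContribution (k N p : nat) : nat :=
  (\sum_(2 <= a < N.+2) p * (N %/ p ^ a) ^ k)%N.

Lemma gcdSum_floor (R : realType) (k : nat) (x : R) : (0 < k)%N ->
  gcdSum k x = (\sum_(0 <= p < (Num.truncn x).+1 | prime p)
                  primeContribution k (Num.truncn x) p)%N :> int.
Proof.
rewrite /gcdSum; set N := Num.truncn x => k0.
have gcd_range (n : {ffun 'I_k -> 'I_N.+1}) : [forall i, (0 < n i)%N] ->
    (0 < \big[gcdn/0%N]_(i < k) n i <= N)%N.
  move=> /forallP n0; set i0 := Ordinal k0.
  have gn : (\big[gcdn/0%N]_(i < k) n i %| n i0)%N by apply: (biggcdn_inf i0).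
  rewrite (dvdn_gt0 (n0 i0) gn) /=.
  by apply: leq_trans (dvdn_leq (n0 i0) gn) _; rewrite -ltnS.
rewrite (eq_bigr _ (fun n n0 => B_sum_prime_powers _ _ (gcd_range n n0))).
rewrite -(big_morph Posz PoszD (erefl (Posz 0))); congr Posz.
rewrite exchange_big; apply: eq_bigr => p _.
rewrite exchange_big /primeContribution; apply: eq_bigr => a _.
by rewrite -big_distrr /= card_tuples_gcd_multiple.
Qed.

(** * Reciprocals of primes *)

Lemma prime_dvd_factorial p n : prime p -> (p %| n`!)%N -> (p <= n)%N.
Proof.
move=> p_pr; elim: n => [|n IH].
  by rewrite dvdn1 => /eqP p1; rewrite p1 in p_pr.
rewrite factS Euclid_dvdM // => /orP[/dvdn_leq -> //|/IH]; exact: leqW.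
Qed.

(** In [(2 n)! = 'C(2 n, n) * (n! * n!)], the prime [p] divides the left-hand
    side but not [n!]. *)
Lemma prime_dvd_central_bin p n : prime p -> (n < p <= n.*2)%N ->
  (p %| 'C(n.*2, n))%N.
Proof.
move=> p_pr /andP[np p2n].
have : (p %| (n.*2)`!)%N by rewrite dvdn_fact // prime_gt0.
have n2 : (n <= n.*2)%N by lia.
rewrite -(bin_fact n2) Euclid_dvdM // => /orP[//|].
have -> : (n.*2 - n = n)%N by lia.
by rewrite Euclid_dvdM // orbb => /(prime_dvd_factorial _ _ p_pr); lia.
Qed.

Lemma central_bin_le n : ('C(n.*2, n) <= 4 ^ n)%N.
Proof.
have -> : (4 ^ n = (1 + 1) ^ n.*2)%N by rewrite -mul2n expnM.
rewrite expnDn (bigD1 (inord n)) //= inordK; last by lia.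
by rewrite !exp1n !muln1 leq_addr.
Qed.

Lemma prod_primes_central_bin n :
  (\prod_(n.+1 <= p < n.*2.+1 | prime p) p <= 4 ^ n)%N.
Proof.
apply: leq_trans (central_bin_le n).
apply: dvdn_leq; first by rewrite bin_gt0; lia.
apply/unstable.Gauss_dvd_prod; last first.
  by move=> p; rewrite mem_index_iota => pn p_pr; apply: prime_dvd_central_bin.
rewrite map_id; apply: (sub_in_pairwise (P := prime) (r := fun p q => p != q)).
- by move=> p q /= p_pr q_pr; rewrite prime_coprime // dvdn_prime2.
- by apply/allP => p; rewrite mem_filter => /andP[].
- by rewrite -uniq_pairwise filter_uniq // iota_uniq.
Qed.

(** With [n = 2 ^ j] and [c] primes in [(n, 2 n]], their product gives
    [n ^ c <= 4 ^ n]; compare the exponents of 2. *)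
Lemma count_primes_dyadic j :
  (j * \sum_((2 ^ j).+1 <= p < (2 ^ j.+1).+1 | prime p) 1 <= 2 ^ j.+1)%N.
Proof.
set c := (\sum_(_ <= p < _ | _) 1)%N.
have pw : ((2 ^ j) ^ c <= 2 ^ (2 ^ j.+1))%N.
  rewrite [in leqRHS]expnS expnM; apply: leq_trans (prod_primes_central_bin (2 ^ j)).
  have -> : ((2 ^ j) ^ c =
      \prod_((2 ^ j).+1 <= p < (2 ^ j.+1).+1 | prime p) 2 ^ j)%N.
    by rewrite big_const_seq iter_muln_1 /c sum1_count.
  rewrite -mul2n -expnS.
  rewrite big_nat_cond [leqRHS]big_nat_cond; apply: leq_prod => p.
  by move=> /andP[/andP[/ltnW]].
by move: pw; rewrite -expnM leq_exp2l.
Qed.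

Lemma sum_inv_primes_dyadic (R : realType) j : (0 < j)%N ->
  \sum_((2 ^ j).+1 <= p < (2 ^ j.+1).+1 | prime p) (p%:R : R)^-1 <= 2 / j%:R.
Proof.
move=> j0.
have j0R : 0 < j%:R :> R by rewrite ltr0n.
have e0 : 0 < (2 ^ j)%:R :> R by rewrite ltr0n expn_gt0.
apply: (@le_trans _ _
  ((\sum_((2 ^ j).+1 <= p < (2 ^ j.+1).+1 | prime p) 1)%N%:R / (2 ^ j)%:R)).
  rewrite natr_sum mulr_suml big_nat_cond [leRHS]big_nat_cond.
  apply: ler_sum => p /andP[/andP[p1 _] _].
  by rewrite mul1r lef_pV2 ?posrE ?ler_nat ?ltr0n //; lia.
rewrite ler_pdivrMr // mulrAC ler_pdivlMr // mulrC -!natrM ler_nat -expnS.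
exact: count_primes_dyadic.
Qed.

(** Induction, the step being [1 / (J+1) <= ln ((J+1) / J)], that is
    [ln (1 - t) <= - t] for [t = 1 / (J+1)]. *)
Lemma harmonic_le_ln (R : realType) J : (0 < J)%N ->
  \sum_(1 <= j < J.+1) (j%:R : R)^-1 <= 1 + ln J%:R.
Proof.
case: J => // J _; elim: J => [|J IH]; first by rewrite big_nat1 ln1 invr1 addr0.
rewrite big_nat_recr //=; apply: le_trans (lerD IH (lexx _)) _.
rewrite -addrA lerD2l -lerBrDl.
have J1 : 0 < J.+1%:R :> R by rewrite ltr0n.
have J2 : 0 < J.+2%:R :> R by rewrite ltr0n.
rewrite -ln_div ?posrE //.
have := @le_ln1Dx R (- J.+2%:R^-1).
have -> : 1 + - J.+2%:R^-1 = J.+1%:R / J.+2%:R :> R.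
  move: J1; rewrite -(natr1 J.+1); move: (J.+1%:R) => y y0.
  by field; rewrite lt0r_neq0 //; lra.
rewrite ltrN2 invf_lt1 // ltr1n => /(_ isT).
by rewrite !ln_div ?posrE // lerNr opprB.
Qed.

(** The prime 2 gives [1 / 2], and the block [(2 ^ j, 2 ^ (j+1)]] gives at most
    [2 / j]. *)
Lemma sum_inv_primes_pow2 (R : realType) J : (0 < J)%N ->
  \sum_(0 <= p < (2 ^ J).+1 | prime p) (p%:R : R)^-1
    <= 2^-1 + 2 * \sum_(1 <= j < J) (j%:R : R)^-1.
Proof.
case: J => // J _; elim: J => [|J IH].
  rewrite expn1 [in leRHS]big_geq // mulr0 addr0 big_mkcond /=.
  by rewrite /index_iota /= !big_cons big_nil /= !(add0r, addr0).
rewrite (big_cat_nat _ (n := (2 ^ J.+1).+1)) //=; last by rewrite ltnS leq_exp2l.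
apply: le_trans (lerD IH (sum_inv_primes_dyadic R J.+1 isT)) _.
by rewrite [in leRHS]big_nat_recr //= mulrDr addrA.
Qed.

(** An upper bound in Mertens' second theorem.  With [2 ^ J <= x < 2 ^ (J+1)]
    the blocks sum to at most [1 / 2 + 2 (1 + ln J)], where [J <= 2 ln x]
    and hence [ln J <= 1 + ln (ln x)].  The hypothesis on [x] says that
    [ln (ln x) >= 1], which absorbs the additive constants. *)
Lemma sum_inv_primes_le_lnln (R : realType) (x : R) : expR (expR 1) <= x ->
  \sum_(0 <= p < (Num.truncn x).+1 | prime p) (p%:R : R)^-1 <= 7 * ln (ln x).
Proof.
move=> xe.
have e1 : (2 : R) <= expR 1 by apply: le_trans (expR_ge1Dx 1).
have ee : (3 : R) <= expR (expR 1).
  by apply: le_trans (expR_ge1Dx _); move: e1; lra.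
have x0 : 0 < x by lra.
have lx : expR 1 <= ln x by rewrite -[leLHS]expRK ler_ln ?posrE ?expR_gt0.
have lx0 : 0 < ln x by lra.
have llx : 1 <= ln (ln x) by rewrite -[leLHS]expRK ler_ln ?posrE ?expR_gt0.
have /andP[Nx xN] := truncn_itv (ltW x0).
set N := Num.truncn x in Nx xN *.
have N2 : (2 <= N)%N.
  by rewrite -ltnS -(ltr_nat R); apply: le_lt_trans xN; lra.
have /andP[] := @trunc_log_bounds 2 N isT (ltnW N2).
set J := trunc_log 2 N => JN NJ.
have J1 : (0 < J)%N by rewrite trunc_log_gt0.
have ln2 : 2^-1 <= ln 2 :> R.
  have := @le_ln1Dx R (- 2^-1); rewrite (_ : 1 + - 2^-1 = 2^-1 :> R); last by lra.
  by rewrite lnV ?posrE // => /(_ _); lra.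
(* [ln 2 >= 1 / 2] turns [2 ^ J <= x] into a bound on [J]. *)
have Jlx : J%:R <= 2 * ln x.
  have : J%:R * ln 2 <= ln x.
    rewrite mulr_natl -lnXn // ler_ln ?posrE ?exprn_gt0 //.
    by rewrite -natrX (le_trans _ Nx) // ler_nat.
  have : 0 <= J%:R * (ln 2 - 2^-1) :> R by rewrite mulr_ge0 //; lra.
  by lra.
have lnJ : ln J%:R <= 1 + ln (ln x).
  apply: (@le_trans _ _ (ln (2 * ln x))).
    by rewrite ler_ln ?posrE ?ltr0n //; lra.
  rewrite lnM ?posrE //; rewrite lerD2r.
  by have := @le_ln1Dx R 1; rewrite (_ : 1 + 1 = 2 :> R) //; apply; lra.
have /= := harmonic_le_ln R J J1.
have /= := sum_inv_primes_pow2 R J.+1 isT.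
set S := (X in X <= _ -> _) => h1 h2.
apply: (@le_trans _ _ S); last by lra.
rewrite /S (big_cat_nat (leq0n N.+1) (leqW NJ)).
by rewrite lerDl sumr_ge0.
Qed.

(** * The terms of the prime series *)

Definition primeTerm (R : realType) (k p : nat) : R :=
  (p%:R ^+ k.-1 * (p%:R ^+ k - 1))^-1.

Lemma inv_sub_inv_pred (R : realType) p : (1 < p)%N ->
  (p.-1%:R : R)^-1 - p%:R^-1 = (p%:R * (p%:R - 1))^-1.
Proof.
case: p => [|[|q]] // _; rewrite /= -(natr1 q.+1) addrK.
have : 0 < q.+1%:R :> R by rewrite ltr0n.
by move: (q.+1%:R) => y y0; field; rewrite !lt0r_neq0 //; lra.
Qed.

Lemma primeTerm_ge0 (R : realType) k p : prime p -> 0 <= primeTerm R k p.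
Proof.
move=> /prime_gt0 p0; rewrite invr_ge0 mulr_ge0 ?exprn_ge0 //.
by rewrite subr_ge0 exprn_ege1 // ler1n.
Qed.

Lemma primeTerm_le_telescope (R : realType) k p : (2 <= k)%N -> prime p ->
  primeTerm R k p <= p.-1%:R^-1 - p%:R^-1.
Proof.
case: k => [|[|k]] // _ p_pr; have p1 := prime_gt1 p_pr.
rewrite inv_sub_inv_pred //.
have p1R : 1 < p%:R :> R by rewrite ltr1n.
have pp j : (p%:R : R) <= p%:R ^+ j.+1.
  by rewrite exprS ler_peMr ?exprn_ege1 //; lra.
have pk := pp k; have pk1 := pp k.+1.
have h : p%:R * (p%:R - 1) <= p%:R ^+ k.+1 * (p%:R ^+ k.+2 - 1) :> R.
  by apply: ler_pM => //; lra.
have h0 : 0 < p%:R * (p%:R - 1) :> R by rewrite mulr_gt0 //; lra.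
by rewrite lef_pV2 ?posrE //; apply: lt_le_trans h.
Qed.

(** The bounds [1 / (p - 1) - 1 / p] are nonnegative at composite [p] too, so the
    sum over primes is at most the telescoping sum over all integers beyond
    [N]. *)
Lemma sum_primes_telescope (R : realType) (f : nat -> R) N M : (0 < N)%N ->
  (forall p, prime p -> f p <= p.-1%:R^-1 - p%:R^-1) ->
  \sum_(N.+1 <= p < M | prime p) f p <= N%:R^-1.
Proof.
move=> N0 fle; case: (leqP M N.+1) => MN; first by rewrite big_geq // invr_ge0.
case: M MN => // M; rewrite ltnS => NM.
apply: (@le_trans _ _ (\sum_(N <= i < M) - (i.+1%:R^-1 - i%:R^-1))); last first.
  by rewrite sumrN telescope_sumr ?(ltnW NM) // opprB lerBlDr lerDl invr_ge0.
rewrite big_mkcond big_add1 /=; apply: ler_sum_nat => i /andP[Ni _].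
rewrite opprB; case: ifP => [/fle //|_].
have i0 : (0 < i)%N by apply: leq_trans Ni.
by rewrite subr_ge0 lef_pV2 ?posrE ?ltr0n // ler_nat.
Qed.

(** Pass to the limit in the partial sums, whose terms beyond [N] are
    nonnegative and telescope. *)
Lemma primeConst_bounds (R : realType) k N : (2 <= k)%N -> (0 < N)%N ->
  primeSeries R k N.+1 <= primeConst R k <= primeSeries R k N.+1 + N%:R^-1.
Proof.
move=> k2 N0; have cv := @is_cvg_primeSeries R k k2.
have cat M : (N < M)%N -> primeSeries R k M =
    primeSeries R k N.+1 + \sum_(N.+1 <= p < M | prime p) primeTerm R k p.
  by move=> NM; rewrite /primeSeries (big_cat_nat (leq0n N.+1) NM).
apply/andP; split.
  apply: limr_ge => //; near=> M.
  have NM : (N < M)%N by near: M; exact: nbhs_infty_gt.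
  by rewrite (cat M) // lerDl sumr_ge0 // => p; exact: primeTerm_ge0.
apply: limr_le => //; near=> M.
have NM : (N < M)%N by near: M; exact: nbhs_infty_gt.
rewrite (cat M) // lerD2l; apply: sum_primes_telescope => // p.
exact: primeTerm_le_telescope.
Unshelve. all: by end_near. Qed.

(** * Error committed at a single prime *)

Lemma geometric_sum_from2 (R : comNzRingType) (r : R) L :
  (1 - r) * \sum_(2 <= a < L.+2) r ^+ a = r ^+ 2 * (1 - r ^+ L).
Proof.
elim: L => [|L IH]; first by rewrite big_geq // expr0 subrr !mulr0.
by rewrite big_nat_recr //= mulrDr IH !exprS; ring.
Qed.

Lemma geometric_sum_from2_le (R : realType) (r : R) L : 0 <= r <= 2^-1 ->
  \sum_(2 <= a < L.+2) r ^+ a <= 2 * r ^+ 2.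
Proof.
move=> /andP[r0 r2]; have := geometric_sum_from2 R r L.
set S := \sum_(_ <= a < _) _ => e.
have S0 : 0 <= S by apply: sumr_ge0 => a _; rewrite exprn_ge0.
have h1 : 0 <= (2^-1 - r) * S by rewrite mulr_ge0 //; lra.
have h2 : 0 <= r ^+ 2 * r ^+ L by rewrite mulr_ge0 ?exprn_ge0.
move: e h1 h2; rewrite mulrBr mulr1 mulrBl mul1r mulrBl; lra.
Qed.

(** The full series [sum_(a >= 2) p * p ^ (- k a)] has value [primeTerm k p];
    what remains after its first [L] terms is [p ^ (- k L)] times the whole. *)
Lemma primeTerm_geometric (R : realType) k p L : (0 < k)%N -> prime p ->
  \sum_(2 <= a < L.+2) p%:R * (p%:R ^+ k)^-1 ^+ a
    = primeTerm R k p * (1 - (p%:R ^+ k)^-1 ^+ L).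
Proof.
case: k => // k _ p_pr; rewrite -mulr_sumr /primeTerm /=.
have p1 : 1 < p%:R :> R by rewrite ltr1n prime_gt1.
have p0 : 0 < p%:R :> R by lra.
have P0 : 0 < p%:R ^+ k :> R by rewrite exprn_gt0.
have Q1 : 1 < p%:R ^+ k.+1 :> R by rewrite exprn_egt1.
have := geometric_sum_from2 R (p%:R ^+ k.+1)^-1 L.
move: (\sum_(_ <= a < _) _) (_ ^+ L) => S e.
move: Q1 P0; rewrite exprS; move: (p%:R ^+ k) => P Q1 P0 E.
have d0 : 1 - (p%:R * P)^-1 != 0.
  by rewrite subr_eq0 eq_sym invr_eq1 gt_eqF.
apply: (mulfI d0); rewrite mulrCA E; field.
by rewrite !lt0r_neq0 // ?subr_gt0.
Qed.

(** Induction on [k], writing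
    [y ^ (k+1) - m ^ (k+1) = y (y ^ k - m ^ k) + m ^ k (y - m)]. *)
Lemma pow_sub_floor_pow (R : realType) (y m : R) k : 0 <= m <= y -> y <= m + 1 ->
  0 <= y ^+ k - m ^+ k <= k%:R * y ^+ k.-1.
Proof.
move=> /andP[m0 my] ym; have y0 : 0 <= y by lra.
have mono j : m ^+ j <= y ^+ j by rewrite lerXn2r.
rewrite subr_ge0 mono /=; elim: k => [|k IH]; first by rewrite subrr mul0r.
have -> : y ^+ k.+1 - m ^+ k.+1 = y * (y ^+ k - m ^+ k) + m ^+ k * (y - m).
  by rewrite !exprS; ring.
rewrite -natr1 mulrDl mul1r; apply: lerD => /=.
  case: k IH => [|k] IH; first by rewrite subrr mulr0 mul0r.
  by rewrite [y ^+ k.+1 as X in _ <= _ * X]exprS mulrCA ler_wpM2l.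
by rewrite -[leRHS]mulr1 ler_pM ?exprn_ge0 //; lra.
Qed.

Lemma truncn_divn_itv (R : realType) (x : R) d : 0 <= x -> (0 < d)%N ->
  let m := (Num.truncn x %/ d)%:R in m <= x / d%:R <= m + 1.
Proof.
move=> x0 d0 /=; have /andP[Nx xN] := truncn_itv x0.
have d0R : 0 < d%:R :> R by rewrite ltr0n.
rewrite ler_pdivlMr // ler_pdivrMr // natr1 -!natrM; apply/andP; split.
  by apply: le_trans Nx; rewrite ler_nat leq_divM.
by apply: le_trans (ltW xN) _; rewrite ler_nat ltn_ceil.
Qed.

(** The first term of the bound is the cost of the floors, the second one that
    of cutting the geometric series after the exponent [N + 1], where [N = floor x]. *)
Lemma primeContribution_approx (R : realType) (x : R) k p :
  (2 <= k)%N -> prime p -> 1 <= x ->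
  0 <= x ^+ k * primeTerm R k p - (primeContribution k (Num.truncn x) p)%:R
    <= 2 * k%:R * x ^+ k.-1 * (p%:R / (p%:R ^+ k.-1) ^+ 2) + primeTerm R k p.
Proof.
move=> k2 p_pr x1; have x0 : 0 <= x by lra.
have /andP[_ xN] := truncn_itv x0.
set N := Num.truncn x in xN *.
have p2 : 2 <= p%:R :> R by rewrite ler_nat prime_gt1.
have [p0 p1] : 0 < p%:R :> R /\ 1 <= p%:R :> R by split; lra.
(* Ensures that the part cut off the geometric series, [c_p (x / p ^ N) ^ k],
   is at most [c_p]. *)
have xpN : x <= p%:R ^+ N.
  apply: le_trans (ltW xN) _; rewrite -natrX ler_nat.
  exact/ltn_expl/prime_gt1.
pose y a : R := x / (p ^ a)%:R.
have yE a j : y a ^+ j = x ^+ j * (p%:R ^+ j)^-1 ^+ a.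
  by rewrite /y expr_div_n natrX exprVn -!exprM mulnC.
have approx a : 0 <= y a ^+ k - (N %/ p ^ a)%:R ^+ k <= k%:R * y a ^+ k.-1.
  have pa0 : (0 < p ^ a)%N by rewrite expn_gt0 prime_gt0.
  have /andP[h1 h2] := truncn_divn_itv R x _ x0 pa0.
  by apply: pow_sub_floor_pow => //; rewrite h1 andbT.
have full : \sum_(2 <= a < N.+2) p%:R * y a ^+ k =
    x ^+ k * primeTerm R k p - primeTerm R k p * y N ^+ k.
  under eq_bigr => a _ do rewrite yE mulrCA.
  by rewrite -mulr_sumr primeTerm_geometric ?(ltnW k2) // yE; ring.
have yN : 0 <= y N ^+ k <= 1.
  have y01 : 0 <= y N <= 1.
    rewrite /y divr_ge0 //= ler_pdivrMr ?mul1r ?natrX //.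
    by rewrite exprn_gt0.
  by case/andP: y01 => ? ?; rewrite exprn_ge0 //= exprn_ile1.
have c0 := primeTerm_ge0 R k p p_pr.
have -> : x ^+ k * primeTerm R k p - (primeContribution k N p)%:R =
    \sum_(2 <= a < N.+2) p%:R * (y a ^+ k - (N %/ p ^ a)%:R ^+ k)
      + primeTerm R k p * y N ^+ k.
  under eq_bigr => a _ do rewrite mulrBr.
  rewrite sumrB full /primeContribution natr_sum.
  under [in LHS]eq_bigr => a _ do rewrite natrM natrX.
  by ring.
have tail0 : 0 <= primeTerm R k p * y N ^+ k <= primeTerm R k p.
  by case/andP: yN => ? ?; rewrite mulr_ge0 //= ler_piMr.
case/andP: tail0 => t0 t1.
apply/andP; split.
  apply: addr_ge0 => //; apply: sumr_ge0 => a _.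
  by rewrite mulr_ge0 ?(ltW p0) //; case/andP: (approx a).
apply: lerD => //.
apply: (@le_trans _ _ (\sum_(2 <= a < N.+2)
    k%:R * x ^+ k.-1 * p%:R * (p%:R ^+ k.-1)^-1 ^+ a)).
  apply: ler_sum => a _.
  have /andP[_ h] := approx a.
  have -> : k%:R * x ^+ k.-1 * p%:R * (p%:R ^+ k.-1)^-1 ^+ a =
    p%:R * (k%:R * (x ^+ k.-1 * (p%:R ^+ k.-1)^-1 ^+ a)) by ring.
  by rewrite -yE ler_wpM2l.
have r2 : 0 <= (p%:R ^+ k.-1 : R)^-1 <= 2^-1.
  have P0 : 0 < p%:R ^+ k.-1 :> R by rewrite exprn_gt0.
  rewrite invr_ge0 (ltW P0) /= lef_pV2 ?posrE //.
  apply: le_trans p2 _; have -> : k.-1 = k.-2.+1 by case: (k) k2 => [|[]].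
  by rewrite exprS ler_peMr // exprn_ege1.
rewrite -mulr_sumr.
have -> : 2 * k%:R * x ^+ k.-1 * (p%:R / (p%:R ^+ k.-1) ^+ 2) =
  k%:R * x ^+ k.-1 * p%:R * (2 * (p%:R ^+ k.-1)^-1 ^+ 2).
  by rewrite exprVn; ring.
by rewrite ler_wpM2l ?geometric_sum_from2_le // !mulr_ge0 ?exprn_ge0 // ltW.
Qed.

(** * The total error *)

(** The sum over [p <= N] of [1 / p ^ (2 k - 3)], written so that no truncated
    subtraction other than [k.-1] occurs. *)
Definition errorSum (R : realType) (k N : nat) : R :=
  \sum_(0 <= p < N.+1 | prime p) p%:R / (p%:R ^+ k.-1) ^+ 2.

(** The coefficient collects the errors due to the floors, to the cut geometric
    series (at most the sum of all [primeTerm]s) and to the primes beyond [x].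
    All three have the same sign, so the absolute value is simply their sum. *)
Lemma gcdSum_error_bound (R : realType) (x : R) k : (2 <= k)%N -> 1 <= x ->
  `|(gcdSum k x)%:~R - x ^+ k * primeConst R k|
    <= (2 * k%:R * errorSum R k (Num.truncn x) + primeConst R k + 2) * x ^+ k.-1.
Proof.
move=> k2 x1; have x0 : 0 <= x by lra.
have /andP[Nx xN] := truncn_itv x0.
rewrite gcdSum_floor ?(ltnW k2) //.
set N := Num.truncn x in Nx xN *.
have N1 : (0 < N)%N by rewrite -ltnS -(ltr_nat R); apply: le_lt_trans xN.
have /andP[c1 c2] := primeConst_bounds R k N k2 N1.
set C := primeConst R k in c1 c2 *.
set S := primeSeries R k N.+1 in c1 c2.
have S0 : 0 <= S by apply: sumr_ge0 => p; exact: primeTerm_ge0.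
have X1 : 1 <= x ^+ k.-1 by rewrite exprn_ege1.
have XkE : x ^+ k = x * x ^+ k.-1 by rewrite -exprS prednK // ltnW.
have tail : 0 <= x ^+ k * (C - S) <= 2 * x ^+ k.-1.
  rewrite mulr_ge0 ?exprn_ge0 ?subr_ge0 //= XkE mulrAC ler_wpM2r ?exprn_ge0 //.
  apply: (@le_trans _ _ (x * N%:R^-1)); first by rewrite ler_wpM2l //; lra.
  rewrite ler_pdivrMr ?ltr0n //; move: xN; rewrite -natr1 => xN.
  have : 1 <= N%:R :> R by rewrite ler1n.
  by lra.
set G := (\sum_(_ <= p < _ | _) _)%N.
have main : 0 <= x ^+ k * S - G%:R
    <= 2 * k%:R * x ^+ k.-1 * errorSum R k N + S.
  rewrite /G natr_sum /S /primeSeries mulr_sumr -sumrB /errorSum mulr_sumr.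
  rewrite -big_split /=; apply/andP; split.
    apply: sumr_ge0 => p p_pr.
    by have /andP[] := primeContribution_approx R x k p k2 p_pr x1.
  apply: ler_sum => p p_pr.
  by have /andP[] := primeContribution_approx R x k p k2 p_pr x1.
have CX : C <= C * x ^+ k.-1 by rewrite ler_peMr //; lra.
have -> : G%:~R - x ^+ k * C = - ((x ^+ k * S - G%:R) + x ^+ k * (C - S)).
  by rewrite pmulrn; ring.
case/andP: main => m1 m2; case/andP: tail => t1 t2.
rewrite normrN (ger0_norm (addr_ge0 m1 t1)).
have -> : (2 * k%:R * errorSum R k N + C + 2) * x ^+ k.-1 =
  2 * k%:R * x ^+ k.-1 * errorSum R k N + C * x ^+ k.-1 + 2 * x ^+ k.-1 by ring.
by lra.
Qed.

(** For [k >= 3] the summand is at most [1 / p ^ 3 <= 1 / (p (p - 1))], which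
    telescopes from [p = 2] on. *)
Lemma errorSum_le1 (R : realType) k N : (3 <= k)%N -> errorSum R k N <= 1.
Proof.
move=> k3; rewrite /errorSum.
have term_le p : prime p ->
    (p%:R / (p%:R ^+ k.-1) ^+ 2 : R) <= p.-1%:R^-1 - p%:R^-1.
  move=> p_pr; rewrite inv_sub_inv_pred ?prime_gt1 //.
  have p1 : 1 < p%:R :> R by rewrite ltr1n prime_gt1.
  have p0 : 0 < p%:R :> R by lra.
  have P0 : 0 < p%:R ^+ k.-1 :> R by rewrite exprn_gt0.
  have pP : p%:R ^+ 2 <= p%:R ^+ k.-1 :> R.
    by rewrite ler_weXn2l ?(ltW p1) //; case: k k3 {P0} => [|[|[|k]]].
  rewrite ler_pdivrMr ?exprn_gt0 // mulrC ler_pdivlMr ?mulr_gt0 ?subr_gt0 //.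
  apply: (@le_trans _ _ ((p%:R ^+ 2) ^+ 2)); last first.
    by rewrite lerXn2r ?nnegrE ?exprn_ge0 // ltW.
  rewrite -subr_ge0.
  have -> : (p%:R ^+ 2) ^+ 2 - p%:R * (p%:R * (p%:R - 1)) =
    p%:R ^+ 2 * (p%:R ^+ 2 - p%:R + 1) :> R by ring.
  rewrite mulr_ge0 ?exprn_ge0 ?(ltW p0) //.
  have : 0 <= p%:R * (p%:R - 1) :> R by rewrite mulr_ge0 //; lra.
  by rewrite expr2; lra.
have -> : \sum_(0 <= p < N.+1 | prime p) (p%:R / (p%:R ^+ k.-1) ^+ 2 : R) =
    \sum_(2 <= p < N.+1 | prime p) (p%:R / (p%:R ^+ k.-1) ^+ 2 : R).
  case: N => [|N]; first by rewrite big_mkcond big_nat1 big_geq.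
  rewrite (big_cat_nat (n := 2)) //= big_mkcond.
  by rewrite /index_iota /= !big_cons big_nil !add0r.
by apply: le_trans (sum_primes_telescope R _ 1 _ isT term_le) _; rewrite invr1.
Qed.

Lemma errorSum2 (R : realType) N :
  errorSum R 2 N = \sum_(0 <= p < N.+1 | prime p) (p%:R)^-1.
Proof.
apply: eq_bigr => p p_pr; rewrite expr1.
have : p%:R != 0 :> R by rewrite pnatr_eq0 -lt0n prime_gt0.
by move=> p0; field.
Qed.

(** * The asymptotic formula *)

Theorem theorem8 (R : realType) (k : nat) (hk : (2 <= k)%N) :
  ((3 <= k)%N ->
     (fun x : R => (gcdSum k x)%:~R : R)
       = (fun x : R => x ^+ k * primeConst R k)
         +O_ (+oo_ R) (fun x : R => x ^+ k.-1)) /\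
  (k = 2%N ->
     (fun x : R => (gcdSum k x)%:~R : R)
       = (fun x : R => x ^+ k * primeConst R k)
         +O_ (+oo_ R) (fun x : R => x * ln (ln x))).
Proof.
have C0 : 0 <= primeConst R k.
  have /andP[+ _] := primeConst_bounds R k 1 hk isT; apply: le_trans.
  by apply: sumr_ge0 => p; exact: primeTerm_ge0.
split=> [k3|k2]; apply/eqaddOP; apply/bigO_exP.
  exists (2 * k%:R + primeConst R k + 2); first by rewrite ltr_wpDl // addr_ge0.
  near=> x.
  have x1 : 1 <= x by near: x; exact: nbhs_pinfty_ge.
  have X0 : 0 <= x ^+ k.-1 by rewrite exprn_ge0 //; lra.
  rewrite (ger0_norm X0).
  apply: le_trans (gcdSum_error_bound R x k hk x1) _.
  by rewrite ler_wpM2r // !lerD2r ler_piMr ?errorSum_le1.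
(* 28 is [2 k = 4] times the constant 7 of [sum_inv_primes_le_lnln]. *)
subst k; exists (28 + primeConst R 2 + 2); first by lra.
near=> x.
have xe : expR (expR 1) <= x by near: x; exact: nbhs_pinfty_ge.
have e1 : 1 <= expR (expR 1) :> R by rewrite -[leLHS]expR0 ler_expR expR_ge0.
have x1 : 1 <= x by lra.
have x0 : 0 < x by lra.
have lx : expR 1 <= ln x by rewrite -[leLHS]expRK ler_ln ?posrE ?expR_gt0.
have lx0 : 0 < ln x by apply: lt_le_trans lx; exact: expR_gt0.
have llx : 1 <= ln (ln x) by rewrite -[leLHS]expRK ler_ln ?posrE ?expR_gt0.
have /= := gcdSum_error_bound R x 2 hk x1; rewrite errorSum2 => h.
set S := (X in 2 * 2 * X) in h.
have hS : S <= 7 * ln (ln x) := sum_inv_primes_le_lnln R x xe.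
have nn : 0 <= x * ln (ln x) by rewrite mulr_ge0 //; lra.
rewrite (ger0_norm nn); apply: le_trans h _.
rewrite expr1 mulrCA [leLHS]mulrC ler_wpM2l ?(ltW x0) //.
have : 0 <= (primeConst R 2 + 2) * (ln (ln x) - 1) by rewrite mulr_ge0 //; lra.
by lra.
Unshelve. all: by end_near. Qed.
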